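(* Let $G=(V,F)$ be a $12$-connected graph on $n$ vertices and let $S\subseteq F$ with $|S|\le 6$. Then $G-S$ is $C_2^1$-rigid, i.e. $F\setminus S$ spans the generic $C_2^1$-cofactor matroid $\mathcal{C}^1_{2,n}$ on $E(K_n)$, where $V$ is identified with $V(K_n)$.
   Context: A graph is $k$-connected if it has at least $k+1$ vertices and remains connected after deleting any fewer than $k$ vertices. Vertices of $K_n$ are $v_1,\dots,v_n$. Choose $p(v_i)=(x_i,y_i)\in\mathbb{R}^2$ with algebraically independent coordinates over $\mathbb{Q}$. $\mathcal{C}^1_{2,n}$ is the row matroid of the $|E(K_n)|\times 3n$ matrix with three columns per vertex. The row of edge $v_iv_j$ with $i<j$ has $D_{ij}=((x_i-x_j)^2,(x_i-x_j)(y_i-y_j),(y_i-y_j)^2)$ in the columns of $v_i$, $-D_{ij}$ in the columns of $v_j$, and zeros elsewhere. A set spans the matroid if its closure is $E(K_n)$. *)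

(* Defs.v *)
From HB Require Import structures.
From mathcomp Require Import all_boot all_order all_algebra.
From mathcomp Require Import mpoly.
From mathcomp Require Import reals.
Set Implicit Arguments. Unset Strict Implicit. Unset Printing Implicit Defensive.
Import Order.TTheory GRing.Theory Num.Theory.
Local Open Scope ring_scope.

Definition edgeK (n : nat) := {e : 'I_n * 'I_n | (e.1 < e.2)%N}.

Definition adj n (F : {set edgeK n}) : rel 'I_n :=
  fun u v => [exists e in F, ((val e).1 == u) && ((val e).2 == v)
                          || ((val e).1 == v) && ((val e).2 == u)].

Definition connected_minus n (F : {set edgeK n}) (U : {set 'I_n}) : Prop :=
  forall u v, u \notin U -> v \notin U ->
    connect [rel x y | adj F x y && (x \notin U) && (y \notin U)] u v.

Definition k_connected n (k : nat) (F : {set edgeK n}) : Prop :=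
  (k.+1 <= n)%N /\ forall U : {set 'I_n}, (#|U| < k)%N -> connected_minus F U.

Definition alg_indep (R : fieldType) m (x : 'I_m -> R) : Prop :=
  forall P : {mpoly rat[m]}, P != 0 -> (map_mpoly (ratr : rat -> R) P).@[x] != 0.

Definition generic_config (R : fieldType) n (p : 'I_n -> R * R) : Prop :=
  alg_indep (fun i : 'I_(n + n) =>
    match split i with inl a => (p a).1 | inr b => (p b).2 end).

Definition Dij (R : ringType) (a b : R * R) (k : nat) : R :=
  let dx := a.1 - b.1 in let dy := a.2 - b.2 in
  if k == 0%N then dx ^+ 2 else if k == 1%N then dx * dy else dy ^+ 2.

Definition cofactor_row (R : ringType) n (p : 'I_n -> R * R) (e : edgeK n)
  : 'rV[R]_(3 * n) :=
  let i := (val e).1 in let j := (val e).2 in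
  \row_(c < 3 * n)
    (if (c %/ 3 == i)%N then Dij (p i) (p j) (c %% 3)
     else if (c %/ 3 == j)%N then - Dij (p i) (p j) (c %% 3) else 0).

(* X spans the row matroid C^1_{2,n}: its closure is all of E(K_n), i.e.
   every row lies in the row space spanned by the rows of X. *)
Definition spans_cofactor (R : fieldType) n (p : 'I_n -> R * R)
  (X : {set edgeK n}) : Prop :=
  forall e : edgeK n,
    (cofactor_row p e <= \sum_(f in X) <<cofactor_row p f>>)%MS.

(* Main.v *)
(** Villanyi's random vertex order argument for d(d+1)-connected graphs.

    Let [h] be the closure of [F :\: S], seen as a graph. Adding a vertex [v] to a
    vertex set in which it has [N] as set of [h]-neighbours raises the rank by at
    least [min(|N|, 3)] (0-extension), and by [4] if [|N| >= 4] and [N] is not a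
    clique of [h] (1-extension). The count may be made in the graph [F]
    extended by [h] instead: each edge of [S] changes it by at most one, so that the
    total cost is [6]. If a vertex has [D] neighbours that do not form with it a
    clique of [h], its expected gain in a uniformly random order is at least
    [7/2 - 6/D], which is [3] for [D = 12]. Hence if no vertex has a clique as
    closed neighbourhood, some order gives rank at least [3n - 6], which is the
    rank of the complete graph. A vertex whose closed neighbourhood is a clique can be
    deleted without harming 12-connectedness, and cliques sharing three vertices
    merge, so that induction applies. *)
Require Import Defs.
From HB Require Import structures.
From mathcomp Require Import all_boot all_order all_algebra.
From mathcomp Require Import mpoly.
From mathcomp Require Import reals.
From mathcomp Require Import ring lra zify.
Set Implicit Arguments. Unset Strict Implicit. Unset Printing Implicit Defensive.
Import Order.TTheory GRing.Theory Num.Theory.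
Local Open Scope ring_scope.

(** * Edge rows and generic placements *)

Section Rows.
Variables (R : comNzRingType) (n : nat).
Implicit Types (p : 'I_n -> R * R) (u v w : 'I_n) (d : 'rV[R]_3).

(** Right multiplication by [block u] puts a 3-vector into the columns of [u], and by its transpose
    reads these columns off. This replaces index arithmetic modulo 3 by matrix algebra. *)
Definition block u : 'M[R]_(3, 3 * n) :=
  \matrix_(k, c) ((c %/ 3 == u)%N && (c %% 3 == k)%N)%:R.

Definition Drow p u v : 'rV[R]_3 := \row_k Dij (p u) (p v) k.

(** Defined for all ordered pairs: swapping the ends changes only the sign, which no span notices,
    and equal ends give zero. *)
Definition edge_row p u v : 'rV[R]_(3 * n) := Drow p u v *m (block u - block v).

Lemma mul_row_block d u (c : 'I_(3 * n)) :
  (d *m block u) 0 c = if (c %/ 3 == u)%N then d 0 (inord (c %% 3)) else 0.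
Proof.
rewrite mxE (bigD1 (inord (c %% 3))) //= big1 ?addr0 => [|k ne].
  rewrite mxE inordK ?ltn_pmod // eqxx andbT.
  by case: ifP; rewrite ?mulr1 ?mulr0.
rewrite mxE; case: (c %% 3 =P k)%N => [E|_]; last by rewrite andbF mulr0.
by case/eqP: ne; apply: val_inj; rewrite /= inordK ?ltn_pmod.
Qed.

Lemma block_tr u v : block u *m (block v)^T = (u == v)%:R%:M.
Proof.
apply/matrixP=> i j; rewrite !mxE.
have lc : (3 * u + i < 3 * n)%N by have := ltn_ord u; have := ltn_ord i; lia.
rewrite (bigD1 (Ordinal lc)) //= big1 ?addr0 => [|c ne].
  have E : ((3 * u + i) %% 3 = i)%N by have := ltn_ord i; lia.
  have E' : ((3 * u + i) %/ 3 = u)%N by have := ltn_ord i; lia.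
  rewrite !mxE /= E E' !eqxx mul1r !val_eqE.
  by case: (u == v) => /=; case: (i == j); rewrite ?mul0rn ?mulr1n.
rewrite !mxE; case: eqP => //= E1; last by rewrite mul0r.
case: eqP => //= E2; last by rewrite mul0r.
case/eqP: ne; apply: val_inj => /=; lia.
Qed.

Lemma Drow_sym p u v : Drow p u v = Drow p v u.
Proof. by apply/rowP=> k; rewrite !mxE /Dij; do !case: ifP => _; ring. Qed.

Lemma edge_row_sym p u v : edge_row p v u = - edge_row p u v.
Proof. by rewrite /edge_row Drow_sym -mulmxN opprB. Qed.

Lemma edge_row_id p u : edge_row p u u = 0.
Proof. by rewrite /edge_row subrr mulmx0. Qed.

Lemma edge_row_tr p u v w :
  edge_row p u v *m (block w)^T
    = ((u == w)%:R - (v == w)%:R) *: Drow p u v.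
Proof. by rewrite /edge_row -mulmxA mulmxBl !block_tr -raddfB /= mul_mx_scalar. Qed.

Lemma cofactor_rowE p (e : edgeK n) :
  cofactor_row p e = edge_row p (val e).1 (val e).2.
Proof.
case: e => [[i j] /= lij]; apply/rowP=> c; rewrite /edge_row mulmxBr !mxE /=.
have := mul_row_block (Drow p i j) i c; rewrite mxE => ->.
have := mul_row_block (Drow p i j) j c; rewrite mxE => ->.
rewrite !mxE inordK ?ltn_pmod //.
case: eqP => [E1|_]; case: eqP => [E2|_]; rewrite ?subr0 ?sub0r //.
by move: lij; rewrite -E1 -E2 ltnn.
Qed.

End Rows.

Definition rat_eval (R : numFieldType) m (x : 'I_m -> R) :
    {rmorphism {mpoly rat[m]} -> R} :=
  meval x \o map_mpoly (ratr : rat -> R).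

Lemma rat_evalX (R : numFieldType) m (x : 'I_m -> R) i : rat_eval x 'X_i = x i.
Proof. by rewrite /= map_mpolyX mevalXU. Qed.

Lemma rank_mxsub (F : fieldType) m n k l (f : 'I_k -> 'I_m) (g : 'I_l -> 'I_n)
  (A : 'M[F]_(m, n)) : (\rank (mxsub f g A) <= \rank A)%N.
Proof.
have rS k' m' n' (f' : 'I_k' -> 'I_m') (B : 'M[F]_(m', n')) :
  (\rank (rowsub f' B) <= \rank B)%N by rewrite rowsubE mxrankM_maxr.
rewrite mxsubrc (leq_trans (rS _ _ _ _ _)) //.
by rewrite -mxrank_tr trmx_mxsub (leq_trans (rS _ _ _ _ _)) ?mxrank_tr.
Qed.

(** Some minor of the size of the rank at [y] is nonzero there, so it is a nonzero polynomial, and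
    it cannot vanish at the algebraically independent [x]. *)
Lemma rank_generic (R : numFieldType) m (x y : 'I_m -> R) r c
    (A : 'M[{mpoly rat[m]}]_(r, c)) :
  alg_indep x -> (\rank (map_mx (rat_eval y) A) <= \rank (map_mx (rat_eval x) A))%N.
Proof.
move=> gx; set B := map_mx (rat_eval y) A.
pose f := maxrankfun B.
have fB : row_full (rowsub f B)^T.
  by rewrite /row_full mxrank_tr -/(row_free _) maxrowsub_free.
have := fullrowsub_unit fB; move: (fullrankfun fB) => g.
rewrite !trmx_mxsub -unitmx_tr !trmx_mxsub trmxK.
have -> : mxsub id g (rowsub f B) = mxsub f g B by rewrite -mxsub_comp.
rewrite unitmxE /B -map_mxsub det_map_mx unitfE => nz.
have dA : \det (mxsub f g A) != 0.
  by apply: contraNneq nz => ->; rewrite rmorph0.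
have : map_mx (rat_eval x) (mxsub f g A) \in unitmx.
  by rewrite unitmxE unitfE det_map_mx; apply: gx.
rewrite map_mxsub => /mxrank_unit <-; exact: rank_mxsub.
Qed.

Definition cross (K : pzRingType) (a b : K * K) : K := a.1 * b.2 - a.2 * b.1.

(** * Specializing polynomial conditions to generic placements *)

Section Config.
Variables (R : numFieldType) (n : nat).

Definition coords (p : 'I_n -> R * R) (i : 'I_(n + n)) : R :=
  match split i with inl a => (p a).1 | inr b => (p b).2 end.

(** The universal placement by indeterminates; its edge rows specialize to those of every
    placement. *)
Definition var_config (u : 'I_n) : {mpoly rat[n + n]} * {mpoly rat[n + n]} :=
  ('X_(lshift n u), 'X_(rshift n u)).

Lemma eval_var1 p u : rat_eval (coords p) (var_config u).1 = (p u).1.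
Proof. by rewrite rat_evalX /coords -[lshift n u]/(unsplit (inl u)) unsplitK. Qed.

Lemma eval_var2 p u : rat_eval (coords p) (var_config u).2 = (p u).2.
Proof. by rewrite rat_evalX /coords -[rshift n u]/(unsplit (inr u)) unsplitK. Qed.

Lemma map_edge_row p u v :
  map_mx (rat_eval (coords p)) (edge_row var_config u v) = edge_row p u v.
Proof.
rewrite /edge_row map_mxM map_mxB; congr (_ *m (_ - _)).
- apply/rowP=> k; rewrite !mxE /Dij.
  have -> : (p u).1 = rat_eval (coords p) (var_config u).1 by rewrite eval_var1.
  have -> : (p v).1 = rat_eval (coords p) (var_config v).1 by rewrite eval_var1.
  have -> : (p u).2 = rat_eval (coords p) (var_config u).2 by rewrite eval_var2.
  have -> : (p v).2 = rat_eval (coords p) (var_config v).2 by rewrite eval_var2.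
  by do 2?case: ifP => _; rewrite ?(rmorphXn, rmorphM, rmorphB).
- by apply/matrixP=> k c; rewrite !mxE; exact: rmorph_nat.
- by apply/matrixP=> k c; rewrite !mxE; exact: rmorph_nat.
Qed.

Definition pair_span p (B : {set 'I_n * 'I_n}) : 'M[R]_(3 * n) :=
  (\sum_(e in B) <<edge_row p e.1 e.2>>)%MS.

Lemma pair_span_sup p (B : {set 'I_n * 'I_n}) u v :
  (u, v) \in B -> (edge_row p u v <= pair_span p B)%MS.
Proof. by move=> uvB; apply: (sumsmx_sup (u, v)); rewrite ?genmxE. Qed.

Lemma pair_spanP p (B : {set 'I_n * 'I_n}) m (A : 'M[R]_(m, 3 * n)) :
  (forall u v, (u, v) \in B -> (edge_row p u v <= A)%MS) ->
  (pair_span p B <= A)%MS.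
Proof.
by move=> BA; apply/sumsmx_subP => -[u v] uvB; rewrite genmxE BA.
Qed.

Lemma pair_span_generic (p p' : 'I_n -> R * R) (B : {set 'I_n * 'I_n}) :
  generic_config p -> (\rank (pair_span p' B) <= \rank (pair_span p B))%N.
Proof.
move=> gp.
pose A := \matrix_(k < #|B|)
  edge_row var_config (enum_val k).1 (enum_val k).2.
have AE q : (pair_span q B :=: map_mx (rat_eval (coords q)) A)%MS.
  apply/eqmxP/andP; split.
    apply: pair_spanP => u v uvB.
    rewrite -map_edge_row -[(u, v)]/((u, v).1, (u, v).2) in uvB *.
    have -> : edge_row var_config u v = row (enum_rank_in uvB (u, v)) A.
      by rewrite rowK enum_rankK_in.
    by rewrite map_row row_sub.
  apply/row_subP => k; rewrite -map_row rowK map_edge_row.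
  by apply: pair_span_sup; rewrite -surjective_pairing enum_valP.
by rewrite !AE; apply: rank_generic.
Qed.

(** A nondegeneracy condition given by a rational polynomial need only be checked at one placement
    [p']; the lemmas below choose placements with coordinates 0 and 1. *)
Lemma generic_neq0 p p' (P : {mpoly rat[n + n]}) :
  generic_config p -> rat_eval (coords p') P != 0 -> rat_eval (coords p) P != 0.
Proof.
by move=> gp nz; apply: gp; apply: contraNneq nz => ->; rewrite rmorph0.
Qed.

Lemma generic_x (p : 'I_n -> R * R) u v :
  generic_config p -> u != v -> (p u).1 != (p v).1.
Proof.
move=> gp uv; pose P := (var_config u).1 - (var_config v).1.
have PE q : rat_eval (coords q) P = (q u).1 - (q v).1.
  by rewrite rmorphB !eval_var1.
rewrite -subr_eq0 -PE; apply: (generic_neq0 (p' := fun w => ((w == u)%:R, 0))) => //.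
by rewrite PE /= eqxx [v == u]eq_sym (negPf uv) subr0 oner_eq0.
Qed.

Lemma generic_y (p : 'I_n -> R * R) u v :
  generic_config p -> u != v -> (p u).2 != (p v).2.
Proof.
move=> gp uv; pose P := (var_config u).2 - (var_config v).2.
have PE q : rat_eval (coords q) P = (q u).2 - (q v).2.
  by rewrite rmorphB !eval_var2.
rewrite -subr_eq0 -PE; apply: (generic_neq0 (p' := fun w => (0, (w == u)%:R))) => //.
by rewrite PE /= eqxx [v == u]eq_sym (negPf uv) subr0 oner_eq0.
Qed.

Definition eval_pt q (a : {mpoly rat[n + n]} * {mpoly rat[n + n]}) : R * R :=
  (rat_eval (coords q) a.1, rat_eval (coords q) a.2).

Lemma eval_ptD q a b : eval_pt q (a + b) = eval_pt q a + eval_pt q b.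
Proof. by congr (_, _); apply: rmorphD. Qed.

Lemma eval_ptB q a b : eval_pt q (a - b) = eval_pt q a - eval_pt q b.
Proof. by congr (_, _); apply: rmorphB. Qed.

Lemma eval_pt_var q u : eval_pt q (var_config u) = q u.
Proof. by rewrite /eval_pt eval_var1 eval_var2 -surjective_pairing. Qed.

Lemma eval_cross q a b :
  rat_eval (coords q) (cross a b) = cross (eval_pt q a) (eval_pt q b).
Proof. by rewrite /cross rmorphB !rmorphM. Qed.

Lemma generic_noncollinear (p : 'I_n -> R * R) u v w :
  generic_config p -> u != v -> u != w -> v != w ->
  cross (p u - p v) (p u - p w) != 0.
Proof.
move=> gp uv uw vw.
pose P := cross (var_config u - var_config v) (var_config u - var_config w).
have PE q : rat_eval (coords q) P = cross (q u - q v) (q u - q w).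
  by rewrite eval_cross !eval_ptB !eval_pt_var.
rewrite -PE.
apply: (generic_neq0 (p' := fun z => ((z == v)%:R, (z == w)%:R))) => //.
rewrite PE /cross /= !eqxx (negPf uv) (negPf uw) (negPf vw) [w == v]eq_sym (negPf vw).
by rewrite /= !(addr0, subr0, sub0r, mulr0, mulrNN, mulr1, oner_eq0).
Qed.

(** [p y *+ 2 - p x] is the reflection of [p x] in [p y], the point at which the 1-extension places
    its new vertex. *)
Lemma generic_reflected_noncollinear (p : 'I_n -> R * R) x y a b :
  generic_config p -> uniq [:: x; y; a; b] ->
  cross (p y *+ 2 - p x - p a) (p y *+ 2 - p x - p b) != 0.
Proof.
move=> gp; rewrite /= !inE !negb_or -!andbA => /and5P[xy xa xb ya /and3P[yb ab _]].
pose c (K : pzRingType) (q : 'I_n -> K * K) := q y *+ 2 - q x.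
pose P := cross (c _ var_config - var_config a) (c _ var_config - var_config b).
have PE q : rat_eval (coords q) P = cross (c _ q - q a) (c _ q - q b).
  by rewrite eval_cross !eval_ptB /c !mulr2n eval_ptD !eval_pt_var.
rewrite -[X in X != 0]PE.
apply: (generic_neq0 (p' := fun z => ((z == a)%:R, (z == b)%:R))) => //.
rewrite PE /cross /c mulr2n /= !eqxx (negPf ya) (negPf yb) (negPf xa) (negPf xb).
rewrite (negPf ab) [b == a]eq_sym (negPf ab).
by rewrite /= !(addr0, subr0, sub0r, mulr0, mulrNN, mulr1, oner_eq0).
Qed.

End Config.

(** * Extensions and trivial motions *)

Lemma rank_add_row (F : fieldType) N (W : 'M[F]_N) (z : 'rV_N) :
  ~~ (z <= W)%MS -> (\rank W + 1 <= \rank (W + <<z>>))%N.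
Proof.
move=> zW; rewrite addn1; suff: (W < W + <<z>>)%MS by rewrite ltmxErank => /andP[].
by rewrite /ltmx addsmxSl /= addsmx_sub submx_refl genmxE.
Qed.

(** The functionals [phi] form a dual family: each one shows that its [z u] lies outside the span of
    [W] and the other rows, so the rows can be split off one by one. *)
Lemma rank_add_independent (F : fieldType) (I : finType) N (W : 'M[F]_N)
    (z : I -> 'rV_N) (M : {set I}) :
  (forall u, u \in M -> exists phi : 'cV_N,
     [/\ W *m phi = 0, z u *m phi != 0 &
         forall w, w \in M -> w != u -> z w *m phi = 0]) ->
  (\rank W + #|M| <= \rank (W + \sum_(u in M) <<z u>>))%N.
Proof.
have [k] := ubnP #|M|; elim: k M => // k IH M leM dual.
have [->|[u uM]] := set_0Vmem M.
  by rewrite cards0 addn0 mxrankS ?addsmxSl.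
rewrite (cardsD1 u) uM addnCA add1n -addn1.
have leM' : (#|M :\ u| < k)%N by move: leM; rewrite (cardsD1 u) uM.
have dual' w : w \in M :\ u -> exists phi : 'cV_N,
     [/\ W *m phi = 0, z w *m phi != 0 &
         forall t, t \in M :\ u -> t != w -> z t *m phi = 0].
  case/setD1P=> _ /dual[phi [? ? h]]; exists phi; split=> // t /setD1P[_ ?].
  exact: h.
have := IH _ leM' dual'; rewrite -(leq_add2r 1) => /leq_trans; apply.
rewrite (big_setD1 (A := M) u) //= (addsmxC <<z u>>%MS) addsmxA.
apply: rank_add_row.
have [phi [W0 zu0 zw0]] := dual _ uM.
apply: contra zu0 => /submxP[D ->]; rewrite -mulmxA.
suff /sub_kermxP-> : (W + \sum_(i in M :\ u) <<z i>> <= kermx phi)%MS.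
  by rewrite mulmx0.
rewrite addsmx_sub; apply/andP; split; first exact/sub_kermxP.
apply/sumsmx_subP=> w /setD1P[wu wM]; rewrite genmxE; apply/sub_kermxP.
exact: zw0.
Qed.

(** * Rank gained by 0-extensions and 1-extensions *)

Section Gains.
Variables (R : numFieldType) (n : nat).
Implicit Types (p : 'I_n -> R * R) (u v w : 'I_n).

(** Coefficients of the quadratic form [cross d a * cross d b] in [d]. Since [Drow] lists the
    quadratic monomials of a difference of points, pairing the two evaluates the form there. *)
Definition quad_form (a b : R * R) : 'cV[R]_3 :=
  \col_k (if k == 0%N :> nat then a.2 * b.2
          else if k == 1%N :> nat then - (a.2 * b.1 + a.1 * b.2)
          else a.1 * b.1).

Lemma Drow_quad_form p u v a b :
  Drow p u v *m quad_form a b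
    = (cross (p u - p v) a * cross (p u - p v) b)%:M.
Proof.
apply/rowP=> i; rewrite ord1 !mxE !big_ord_recl big_ord0 !mxE /= /Dij /cross /=.
by rewrite mulr1n; ring.
Qed.

Lemma cross_vv (a : R * R) : cross a a = 0.
Proof. by rewrite /cross mulrC subrr. Qed.

Lemma cross_ex (a : R * R) : a != 0 -> exists b, cross a b != 0.
Proof.
case: a => x y; rewrite xpair_eqE negb_and => /orP[x0|y0].
  by exists (0, 1); rewrite /cross /= mulr1 mulr0 subr0.
by exists (1, 0); rewrite /cross /= mulr1 mulr0 sub0r oppr_eq0.
Qed.

(** In the columns of [v] the new rows are the quadratic monomials of at most three pairwise
    nonparallel directions. A product of two linear forms, each killing one of the other directions,
    is the dual functional needed. *)
Lemma rank_0extension p v (W : 'M[R]_(3 * n)) (M : {set 'I_n}) :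
  W *m (block R v)^T = 0 -> (#|M| <= 3)%N -> v \notin M ->
  (forall u, u \in M -> p v != p u) ->
  (forall u w, u \in M -> w \in M -> u != w ->
     cross (p v - p u) (p v - p w) != 0) ->
  (\rank W + #|M| <= \rank (W + \sum_(u in M) <<edge_row p v u>>))%N.
Proof.
move=> W0 M3 vM ne np; apply: rank_add_independent => u uM.
suff [a [b [ua ub ab]]] : exists a b, [/\ cross (p v - p u) a != 0,
    cross (p v - p u) b != 0 & forall w, w \in M -> w != u ->
      cross (p v - p w) a * cross (p v - p w) b = 0].
  have E w : w \in M -> edge_row p v w *m ((block R v)^T *m quad_form a b)
      = (cross (p v - p w) a * cross (p v - p w) b)%:M.
    move=> wM; rewrite mulmxA edge_row_tr eqxx.
    have -> : (w == v) = false by apply: contraNF vM => /eqP <-.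
    by rewrite subr0 scale1r Drow_quad_form.
  exists ((block R v)^T *m quad_form a b); split.
  - by rewrite mulmxA W0 mul0mx.
  - rewrite E //; apply/eqP => /matrixP/(_ 0 0)/eqP; rewrite !mxE /= mulr1n.
    by rewrite mulf_eq0 (negPf ua) (negPf ub).
  - by move=> w wM wu; rewrite E // ab // raddf0.
(* [c] supplies the factors left over when [u] has fewer than two companions in [M]. *)
have [c uc] : exists c, cross (p v - p u) c != 0.
  by apply: cross_ex; rewrite subr_eq0 ne.
have npu w : w \in M :\ u -> cross (p v - p u) (p v - p w) != 0.
  by case/setD1P=> wu wM; apply: np => //; rewrite eq_sym.
have : (size (enum (M :\ u)) <= 2)%N.
  by rewrite -cardE; move: M3; rewrite (cardsD1 u) uM.
have mE w : (w \in enum (M :\ u)) = (w \in M :\ u) by rewrite mem_enum.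
have inE' w : w \in M -> w != u -> w \in enum (M :\ u).
  by move=> wM wu; rewrite mE !inE wu.
move: mE inE'; case: (enum _) => [|w1 [|w2 [|//]]] mE inE' _.
- by exists c, c; split=> // w wM wu; have := inE' w wM wu; rewrite in_nil.
- exists (p v - p w1), c; split=> //; first by rewrite npu // -mE inE eqxx.
  move=> w wM wu; have := inE' w wM wu; rewrite inE => /eqP->.
  by rewrite cross_vv mul0r.
- exists (p v - p w1), (p v - p w2).
  split; try by rewrite npu // -mE !inE eqxx ?orbT.
  move=> w wM wu; have := inE' w wM wu; rewrite !inE => /orP[]/eqP->;
    by rewrite cross_vv ?mul0r ?mulr0.
Qed.

Definition pairs (h : rel 'I_n) (X : {set 'I_n}) : {set 'I_n * 'I_n} :=
  [set e | [&& e.1 \in X, e.2 \in X & h e.1 e.2]].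

Lemma pair_span_off p h (X : {set 'I_n}) v :
  v \notin X -> pair_span p (pairs h X) *m (block R v)^T = 0.
Proof.
move=> vX; apply/sub_kermxP/pair_spanP => u w; rewrite inE /= => /and3P[uX wX _].
apply/sub_kermxP; rewrite edge_row_tr.
have -> : (u == v) = false by apply: contraNF vX => /eqP <-.
have -> : (w == v) = false by apply: contraNF vX => /eqP <-.
by rewrite subrr scale0r.
Qed.

Lemma pair_spanS p (A B : {set 'I_n * 'I_n}) :
  A \subset B -> (pair_span p A <= pair_span p B)%MS.
Proof. by move/subsetP=> AB; apply: pair_spanP => u v /AB; apply: pair_span_sup. Qed.

Lemma rank_pairs_0extension p (h : rel 'I_n) v (X M : {set 'I_n}) :
  generic_config p -> v \notin X -> M \subset X -> (#|M| <= 3)%N ->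
  (forall u, u \in M -> h v u) ->
  (\rank (pair_span p (pairs h X)) + #|M|
     <= \rank (pair_span p (pairs h (v |: X))))%N.
Proof.
move=> gp vX /subsetP MX M3 hM.
have vu u : u \in M -> v != u.
  by move=> /MX uX; apply: contraNneq vX => ->.
have := @rank_0extension p v (pair_span p (pairs h X)) M.
move=> /(_ (pair_span_off _ _ vX) M3) H.
apply: leq_trans (H _ _ _) _.
- by apply: contra vX => /MX.
- by move=> u /vu ?; apply: contraNneq (generic_x gp (u := v) (v := u) _) => // ->.
- by move=> u w uM wM uw; apply: generic_noncollinear => //; apply: vu.
apply: mxrankS; rewrite addsmx_sub; apply/andP; split.
  apply: pair_spanS; apply/subsetP=> e; rewrite !inE => /and3P[-> -> ->].
  by rewrite !orbT.
apply/sumsmx_subP => u uM; rewrite genmxE; apply: pair_span_sup.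
by rewrite !inE /= eqxx (MX _ uM) orbT hM.
Qed.

(* Placing [v] at the point [2 p y - p x] of the line [xy] makes the rows of [vx]
   and [vy] generate that of [xy]; genericity can only increase the rank. *)
Lemma rank_pairs_1extension p (h : rel 'I_n) v (X : {set 'I_n}) x y a b :
  generic_config p -> v \notin X -> {subset [:: x; y; a; b] <= X} ->
  uniq [:: x; y; a; b] -> {in [:: x; y; a; b], forall u, h v u} ->
  ~~ (edge_row p x y <= pair_span p (pairs h X))%MS ->
  (\rank (pair_span p (pairs h X)) + 4
     <= \rank (pair_span p (pairs h (v |: X))))%N.
Proof.
move=> gp vX sX uq hv nxy.
pose p' u := if u == v then p y *+ 2 - p x else p u.
have pX u : u \in X -> p' u = p u.
  by move=> uX; rewrite /p'; case: eqP => // uv; rewrite -uv uX in vX.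
have pv : p' v = p y *+ 2 - p x by rewrite /p' eqxx.
have [xX yX aX bX] : [/\ x \in X, y \in X, a \in X & b \in X].
  by split; apply: sX; rewrite !inE eqxx ?orbT.
have WE : pair_span p (pairs h X) = pair_span p' (pairs h X).
  apply: eq_bigr => -[u w]; rewrite inE /= => /and3P[uX wX _]; congr (<<_>>)%MS.
  by rewrite /edge_row; congr (_ *m _); apply/rowP=> k; rewrite !mxE !pX.
set W := pair_span p _ in WE nxy *.
have uq' := uq; rewrite /= !inE !negb_or -!andbA in uq'.
pose W1 := (W + <<edge_row p x y>>)%MS.
apply: leq_trans (pair_span_generic p' _ gp).
have rk1 : (\rank W + 1 <= \rank W1)%N by apply: rank_add_row.
have /and5P[xy xa xb ya /and3P[yb ab _]] := uq'.
(* [y] is left out, because at [p'] it is collinear with [v] and [x]. The row of [vy] serves instead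
   to recover that of [xy], which [W1] contains. *)
pose M := [set x; a; b].
have M3 : #|M| = 3.
  by rewrite /M setUC cardsU1 !inE cards2 xa eq_sym (negPf xb) eq_sym (negPf ab).
have MX u : u \in M -> u \in X.
  by rewrite !inE => /orP[/orP[]|]/eqP->.
have vM : v \notin M by apply: contra vX; apply: MX.
have W10 : W1 *m (block R v)^T = 0.
  apply/sub_kermxP; rewrite addsmx_sub genmxE; apply/andP; split.
    by apply/sub_kermxP; apply: pair_span_off.
  apply/sub_kermxP; rewrite edge_row_tr.
  have -> : (x == v) = false by apply: contraNF vX => /eqP <-.
  have -> : (y == v) = false by apply: contraNF vX => /eqP <-.
  by rewrite subrr scale0r.
have cr u w : u \in M -> w \in M -> u != w ->
    cross (p' v - p' u) (p' v - p' w) != 0.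
  have crC (c d : R * R) : cross d c = - cross c d by rewrite /cross; ring.
  have cx t : t \in [:: a; b] -> cross (p' v - p x) (p' v - p t) != 0.
    move=> tab; have -> : cross (p' v - p x) (p' v - p t)
        = 2 * cross (p y - p x) (p y - p t).
      by rewrite pv /cross /= mulr2n /=; ring.
    rewrite mulf_neq0 ?pnatr_eq0 // generic_noncollinear //.
    - by move: xy; rewrite eq_sym.
    - by move: tab; rewrite !inE => /orP[]/eqP->.
    - by move: tab; rewrite !inE => /orP[]/eqP->.
  have cab : cross (p' v - p a) (p' v - p b) != 0.
    by rewrite pv generic_reflected_noncollinear.
  move=> uM wM; rewrite (pX u) ?(pX w) ?MX //; move: uM wM; rewrite !inE -!orbA.
  case/or3P=> /eqP-> /or3P[]/eqP->; rewrite ?eqxx // => _;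
    rewrite ?cab ?cx ?inE ?eqxx ?orbT //;
    rewrite crC oppr_eq0 ?cab ?cx ?inE ?eqxx ?orbT //.
have nz u : u \in M -> p' v != p' u.
  move=> uM; apply/eqP=> E.
  have [w wM uw] : exists2 w, w \in M & u != w.
    have : (0 < #|M :\ u|)%N by have := cardsD1 u M; rewrite uM M3; case: #|_|.
    by case/card_gt0P=> w /setD1P[wu wM]; exists w; rewrite // eq_sym.
  by have := cr _ _ uM wM uw; rewrite E subrr /cross /= !mul0r subrr eqxx.
have := rank_0extension W10 _ vM nz cr; rewrite M3 => /(_ isT) rk2.
have -> : (\rank W + 4 = \rank W + 1 + 3)%N by rewrite -addnA.
apply: leq_trans (leq_trans (leq_add rk1 (leqnn 3)) rk2) _.
apply: mxrankS.
have in_span u : u \in [:: x; y; a; b] ->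
    (edge_row p' v u <= pair_span p' (pairs h (v |: X)))%MS.
  move=> us; apply: pair_span_sup; rewrite !inE /= eqxx (sX _ us) orbT.
  exact: hv.
rewrite !addsmx_sub genmxE -!andbA; apply/and3P; split.
- rewrite WE; apply: pair_spanS; apply/subsetP=> e; rewrite !inE.
  by case/and3P=> -> -> ->; rewrite !orbT.
(* The difference from [x] to [v] is twice that from [x] to [y], and entries are quadratic, whence
   the factor 4; the difference from [y] to [v] equals that from [x] to [y]. *)
- have -> : edge_row p x y = edge_row p' v y - 4^-1 *: edge_row p' v x.
    have -> : edge_row p' v y = Drow p x y *m (block R v - block R y).
      congr (_ *m _); apply/rowP=> k; rewrite !mxE pv pX // /Dij /= ?mulr2n /=.
      by do 2?case: ifP => _; ring.
    have -> : edge_row p' v x = (4 *: Drow p x y) *m (block R v - block R x).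
      congr (_ *m _); apply/rowP=> k; rewrite !mxE pv pX // /Dij /= ?mulr2n /=.
      by do 2?case: ifP => _; ring.
    rewrite -scalemxAl scalerA mulVf ?pnatr_eq0 // scale1r -mulmxBr.
    by rewrite opprB addrC addrA subrK.
  by rewrite addmx_sub ?eqmx_opp ?scalemx_sub ?in_span // !inE eqxx ?orbT.
- apply/sumsmx_subP=> u uM; rewrite genmxE in_span //.
  by move: uM; rewrite !inE => /orP[/orP[]|] ->; rewrite ?orbT.
Qed.

End Gains.

(** * Trivial motions and the rank bound for complete graphs *)

Section Motions.
Variables (R : numFieldType) (n : nat).
Implicit Types (p : 'I_n -> R * R) (u v w : 'I_n).

(* The six columns span the trivial motions: vector fields [q] on the plane with
   [Dij a b . (q a - q b) = 0] for all points [a], [b]. *)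
Definition motion_at (a : R * R) : 'M[R]_(3, 6) :=
  let: (x, y) := a in
  \matrix_(k, l) nth 0 (nth [::]
    [:: [:: 1; 0; 0;   y;   0;           y ^+ 2];
        [:: 0; 1; 0; - x;   y; - (2 * (x * y))];
        [:: 0; 0; 1;   0; - x;           x ^+ 2]] k) l.

Definition motions p : 'M[R]_(3 * n, 6) :=
  \sum_u (block R u)^T *m motion_at (p u).

Lemma block_motions p u : block R u *m motions p = motion_at (p u).
Proof.
rewrite mulmx_sumr (bigD1 u) //= big1 => [|v vu]; rewrite mulmxA block_tr.
  by rewrite eqxx mul1mx addr0.
by rewrite eq_sym (negPf vu) raddf0 mul0mx.
Qed.

Lemma edge_row_motions p u v : edge_row p u v *m motions p = 0.
Proof.
rewrite /edge_row -mulmxA mulmxBl !block_motions.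
apply/rowP=> l; rewrite !mxE !big_ord_recl big_ord0 !mxE /=.
case: (p u) (p v) => [x y] [x' y']; rewrite !mxE /Dij /=.
by case: l => [[|[|[|[|[|[|]]]]]] ?] //=; ring.
Qed.

(* A trivial motion vanishing at three points with distinct coordinates is zero:
   its last component is a quadratic in [x] with three roots. *)
Lemma motion_eq0 (a b c : R * R) (f : 'cV[R]_6) :
  a.1 != b.1 -> a.1 != c.1 -> b.1 != c.1 -> a.2 != b.2 ->
  motion_at a *m f = 0 -> motion_at b *m f = 0 -> motion_at c *m f = 0 -> f = 0.
Proof.
case: a b c => [x1 y1] [x2 y2] [x3 y3] /= x12 x13 x23 y12.
have E x y : motion_at (x, y) *m f = 0 ->
  [/\ f (inord 0) 0 + y * f (inord 3) 0 + y ^+ 2 * f (inord 5) 0 = 0,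
      f (inord 1) 0 - x * f (inord 3) 0 + y * f (inord 4) 0
        - 2 * (x * y) * f (inord 5) 0 = 0
    & f (inord 2) 0 - x * f (inord 4) 0 + x ^+ 2 * f (inord 5) 0 = 0].
  move=> /matrixP m0.
  have sumE (g : 'I_6 -> R) : \sum_j g j = g (inord 0) + g (inord 1)
      + g (inord 2) + g (inord 3) + g (inord 4) + g (inord 5).
    rewrite !big_ord_recl big_ord0 addr0 !addrA.
    by do 5?[congr (_ + _)]; congr (g _); apply: val_inj; rewrite /= inordK.
  have m k : \sum_j motion_at (x, y) k j * f j 0 = 0.
    by have := m0 k 0; rewrite !mxE.
  have := m (inord 0); have := m (inord 1); have := m (inord 2).
  rewrite !sumE !mxE !inordK //= => e2 e1 e0.
  by split; [rewrite -e0 | rewrite -e1 | rewrite -e2]; ring.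
move=> /E[a1 b1 c1] /E[a2 b2 c2] /E[_ _ c3].
have cancel (s t : R) : s != 0 -> s * t = 0 -> t = 0.
  by move=> s0 /eqP; rewrite mulf_eq0 (negPf s0) => /eqP.
have f5 : f (inord 5) 0 = 0.
  apply: (cancel ((x1 - x2) * (x1 - x3) * (x2 - x3))).
    by rewrite !mulf_neq0 ?subr_eq0.
  have -> : (x1 - x2) * (x1 - x3) * (x2 - x3) * f (inord 5) 0
     = (x2 - x3) * (f (inord 2) 0 - x1 * f (inord 4) 0 + x1 ^+ 2 * f (inord 5) 0)
     - (x1 - x3) * (f (inord 2) 0 - x2 * f (inord 4) 0 + x2 ^+ 2 * f (inord 5) 0)
     + (x1 - x2) * (f (inord 2) 0 - x3 * f (inord 4) 0 + x3 ^+ 2 * f (inord 5) 0).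
    by ring.
  by rewrite c1 c2 c3; ring.
rewrite f5 !mulr0 !addr0 ?subr0 in a1 b1 c1 a2 b2 c2.
have f4 : f (inord 4) 0 = 0.
  apply: (cancel (x2 - x1)); first by rewrite subr_eq0 eq_sym.
  have -> : (x2 - x1) * f (inord 4) 0
    = (f (inord 2) 0 - x1 * f (inord 4) 0) - (f (inord 2) 0 - x2 * f (inord 4) 0).
    by ring.
  by rewrite c1 c2 subrr.
have f3 : f (inord 3) 0 = 0.
  apply: (cancel (y1 - y2)); first by rewrite subr_eq0.
  have -> : (y1 - y2) * f (inord 3) 0
    = (f (inord 0) 0 + y1 * f (inord 3) 0) - (f (inord 0) 0 + y2 * f (inord 3) 0).
    by ring.
  by rewrite a1 a2 subrr.
rewrite f3 f4 !mulr0 ?subr0 !addr0 in a1 b1 c1.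
apply/colP=> i; rewrite mxE -[i]inord_val.
by case: i => [[|[|[|[|[|[|]]]]]] ?] //=.
Qed.

(** The rows lie in the space [T] of vectors supported on [U], of dimension at most [3 * #|U|], and
    are killed by the six motions. These are independent on [T], since a motion vanishing at three
    points of [U] is zero. *)
Lemma rank_pair_span_le p (U : {set 'I_n}) (B : {set 'I_n * 'I_n}) :
  generic_config p -> (2 < #|U|)%N -> B \subset setX U U ->
  (\rank (pair_span p B) + 6 <= 3 * #|U|)%N.
Proof.
move=> gp U3 /subsetP BU.
pose T : 'M[R]_(3 * n) := (\sum_(u in U) <<block R u>>)%MS.
have bT u : u \in U -> (block R u <= T)%MS.
  by move=> uU; rewrite (sumsmx_sup u) ?genmxE.
have rT : (\rank T <= 3 * #|U|)%N.
  rewrite [(3 * #|U|)%N]mulnC -sum_nat_const (leq_trans (mxrank_sum_leqif _)) //=.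
  by apply: leq_sum => u _; rewrite genmxE rank_leq_row.
apply: leq_trans rT; rewrite -(mxrank_mul_ker T (motions p)) addnC leq_add //.
  suff : row_free (T *m motions p)^T by rewrite /row_free mxrank_tr => /eqP->.
  apply: inj_row_free => v; rewrite -[v]trmxK -trmx_mul => /(canRL trmxK).
  move: (v^T) => f; rewrite trmx0 => Tf.
  have mf u : u \in U -> motion_at (p u) *m f = 0.
    move=> /bT/submxP[D E]; rewrite -block_motions E -!mulmxA [T *m _]mulmxA.
    by rewrite Tf mulmx0.
  have [s [us ss /allP sU]] : exists s, [/\ uniq s, size s = 3 & all (mem U) s].
    exists (take 3 (enum U)); split.
    - by rewrite take_uniq ?enum_uniq.
    - rewrite size_take -cardE; case: ltnP => // U3'.
      by apply/eqP; rewrite eqn_leq U3 andbT.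
    - by apply/allP=> u /mem_take; rewrite mem_enum.
  case: s us ss sU => [|a [|b [|c []]]] //= abc _ sU.
  move: abc; rewrite !inE negb_or => /and3P[/andP[ab ac] bc _].
  rewrite (@motion_eq0 (p a) (p b) (p c) f) ?trmx0 ?generic_x ?generic_y //;
    apply: mf; apply: sU; by rewrite !inE eqxx ?orbT.
apply: mxrankS; apply: pair_spanP => u v /BU; rewrite inE => /andP[uU vU].
rewrite sub_capmx; apply/andP; split; last exact/sub_kermxP/edge_row_motions.
rewrite /edge_row mulmxBr addmx_sub ?eqmx_opp //.
  by rewrite (submx_trans (submxMl _ _)) ?bT.
by rewrite (submx_trans (submxMl _ _)) ?bT.
Qed.

End Motions.

(** * Averaging over vertex orders *)

Section Average.
Variables (V : finType) (e : rel V).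
Implicit Types (U X : {set V}) (v w : V).

Definition nbrs v U := [set u in U | e v u].

(* Derandomized averaging over all orders of [U]: [a v X] bounds from below the
   expected increase of [Phi] caused by [v], [g] being evaluated at the set of
   those neighbours in [X] that precede [v]. *)
Lemma order_average (Phi : {set V} -> rat) (g a : V -> {set V} -> rat) :
  irreflexive e -> 0 <= Phi set0 ->
  (forall v X, v \notin X -> Phi X + g v (nbrs v X) <= Phi (v |: X)) ->
  (forall v X, (#|X|.+1)%:R * a v X <= g v X + \sum_(x in X) a v (X :\ x)) ->
  forall U, \sum_(v in U) a v (nbrs v U) <= Phi U.
Proof.
move=> eI Phi0 gain rec U.
have [k] := ubnP #|U|; elim: k U => // k IH U leU.
have [->|[u0 u0U]] := set_0Vmem U; first by rewrite big_set0.
have cU : 0 < #|U|%:R :> rat by rewrite ltr0n card_gt0; apply/set0Pn; exists u0.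
rewrite -(ler_pM2l cU) [leRHS]mulr_natl -[leRHS]sumr_const.
(* [#|U|] copies of [Phi U] are bounded by letting each [v] of [U] come last in turn, with the
   induction hypothesis for [U :\ v]. *)
apply: (@le_trans _ _ (\sum_(v in U)
  (\sum_(w in U :\ v) a w (nbrs w U :\ v) + g v (nbrs v U)))); last first.
  apply: ler_sum => v vU.
  have nE : nbrs v (U :\ v) = nbrs v U.
    by apply/setP=> u; rewrite !inE; case: (u =P v) => [->|//]; rewrite eI !andbF.
  have := gain v (U :\ v); rewrite !inE eqxx setD1K // nE => /(_ isT).
  apply: le_trans; rewrite lerD2r.
  have leU' : (#|U :\ v| < k)%N by move: leU; rewrite (cardsD1 v) vU.
  apply: le_trans (IH _ leU').
  rewrite le_eqVlt (eq_bigr (fun w => a w (nbrs w (U :\ v)))) ?eqxx // => w _.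
  by congr (a w _); apply/setP=> u; rewrite !inE andbA.
rewrite big_split /=.
have -> : \sum_(v in U) \sum_(w in U :\ v) a w (nbrs w U :\ v)
        = \sum_(w in U) \sum_(v in U :\ w) a w (nbrs w U :\ v).
  rewrite (exchange_big_dep (mem U)) /= => [|v w _ /setD1P[]//].
  by apply: eq_bigr => w wU; apply: eq_bigl => v; rewrite !inE wU andbT andbC eq_sym.
rewrite mulr_sumr -big_split /=; apply: ler_sum => w wU.
have NU : nbrs w U \subset U :\ w.
  apply/subsetP=> u; rewrite !inE => /andP[->].
  by case: (u =P w) => [->|//]; rewrite eI.
(* Deleting a non-neighbour of [w] leaves its neighbour set unchanged; the deletions of neighbours
   are those counted in [rec]. *)
rewrite (bigID (mem (nbrs w U))) /=.
have -> : \sum_(v in U :\ w | v \in nbrs w U) a w (nbrs w U :\ v)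
        = \sum_(v in nbrs w U) a w (nbrs w U :\ v).
  apply: eq_bigl => v; rewrite andbC; case: (boolP (v \in nbrs w U)) => //=.
  by move/(subsetP NU) => ->.
have -> : \sum_(v in U :\ w | v \notin nbrs w U) a w (nbrs w U :\ v)
        = (#|U :\ w| - #|nbrs w U|)%:R * a w (nbrs w U).
  rewrite -(setIidPr NU) -cardsD (setIidPr NU) mulr_natl -sumr_const.
  apply: eq_big => [v|v /andP[_ vN]]; first by rewrite !inE andbC.
  congr (a w _); apply/setP=> u; rewrite in_setD1.
  by case: eqP => //= ->; rewrite (negPf vN).
have := rec w (nbrs w U).
have := subset_leq_card NU; rewrite (cardsD1 w U) wU => leN.
have -> : (true + #|U :\ w|)%:R
    = (#|U :\ w| - #|nbrs w U|)%:R + (#|nbrs w U|.+1)%:R :> rat.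
  by rewrite -natrD addnS subnK.
by rewrite mulrDl => H; lra.
Qed.

End Average.

(** * The expected gain of a vertex *)

Section Clique.
Variables (V : finType) (h : rel V).

Definition clique (X : {set V}) := [forall u in X, forall v in X, h u v].

Lemma cliqueP (X : {set V}) :
  reflect {in X &, forall u v, h u v} (clique X).
Proof.
apply: (iffP 'forall_in_'forall_in_idP) => H u; first by move=> v /H; apply.
by move=> uX v; apply: H.
Qed.

Lemma cliqueS (A B : {set V}) : A \subset B -> clique B -> clique A.
Proof.
by move=> /subsetP AB /cliqueP cB; apply/cliqueP=> u v /AB uB /AB; apply: cB.
Qed.

(** The bonus of the 1-extension depends on [v |: X], not on [X] alone, because the graph in which
    neighbours are counted may join [v] to vertices not related to it by [h]. *)
Definition gain v (X : {set V}) : nat :=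
  (minn #|X| 3 + ((3 < #|X|) && ~~ clique (v |: X)))%N.

(* Expectation of [gain v] at the set of those elements of [X] that precede [v] in
   a uniformly random order; the last case of [mean_gain] is only a lower bound. *)
Definition mean_small (D : nat) : rat :=
  if (D <= 2)%N then D%:R / 2 else 3 - 6 / D.+1%:R.

Definition mean_gain v (X : {set V}) : rat :=
  if (#|X| <= 3)%N || clique (v |: X) then mean_small #|X|
  else 7 / 2 - 6 / #|X|%:R.

Hypothesis merge : forall A B : {set V}, clique A -> clique B ->
  (2 < #|A :&: B|)%N -> clique (A :|: B).

(** Conditioning on the last element of [v |: X]: if it is [v], the gain is [gain v X]; if it is
    [x], the mean for [X :\ x] remains. In the small case this is an equality for the mean of
    [minn k 3] with [k] uniform on [0..D]. *)
Lemma mean_gain_rec v (X : {set V}) : (#|X|.+1)%:R * mean_gain v X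
  <= (gain v X)%:R + \sum_(x in X) mean_gain v (X :\ x).
Proof.
have cX x : x \in X -> #|X :\ x| = #|X|.-1 by move=> xX; rewrite (cardsD1 x X) xX.
have [small|] := boolP ((#|X| <= 3)%N || clique (v |: X)).
  rewrite (eq_bigr (fun=> mean_small #|X|.-1)) => [|x xX]; last first.
    rewrite /mean_gain cX //; case: ifP => // /negP[].
    case/orP: small => [s|c]; first by rewrite (leq_trans (leq_pred _) s).
    by rewrite (cliqueS _ c) ?orbT ?setUS ?subD1set.
  rewrite sumr_const /mean_gain small /gain.
  have -> : (3 < #|X|)%N && ~~ clique (v |: X) = false.
    by apply/negP=> /andP[? /negP nc]; case/orP: small => //; rewrite leqNgt => /negP.
  rewrite addn0 -[_ *+ #|X|]mulr_natl /mean_small.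
  rewrite /minn; case: #|X| => [|[|[|[|D]]]]; rewrite /=;
    [by lra|by lra|by lra|by lra|].
  have D1 : D.+4%:R != 0 :> rat by rewrite pnatr_eq0.
  have D2 : D.+4.+1%:R != 0 :> rat by rewrite pnatr_eq0.
  rewrite !mulrBr ![_ * (6 / _)]mulrCA !divff //.
  by rewrite -(natr1 D.+4); lra.
rewrite negb_or -ltnNge => /andP[X4 nc].
have E : mean_gain v X = 7 / 2 - 6 / #|X|%:R.
  by rewrite /mean_gain leqNgt X4 (negPf nc).
have Eg : gain v X = 4 by rewrite /gain X4 nc (minn_idPr _) // ltnW.
rewrite E Eg.
(* For four elements every deletion leads to the small case, and both sides equal 10. *)
have [X5|] := ltnP 4 #|X|; last first.
  move=> X4'; have X4E : #|X| = 4 by apply/eqP; rewrite eqn_leq X4' X4.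
  rewrite (eq_bigr (fun=> mean_small 3)) => [|x xX]; last first.
    by rewrite /mean_gain cX // X4E.
  by rewrite sumr_const X4E -[_ *+ 4]mulr_natl /mean_small /=; lra.
(* Two such cliques would share at least three vertices, as [#|X| >= 5], and merge to [v |: X]. So
   at most one deletion [x0] loses the bonus. *)
have uniq_clique x y : x \in X -> y \in X -> clique (v |: X :\ x) ->
    clique (v |: X :\ y) -> x = y.
  move=> xX yX cx cy; apply: contraNeq nc => xy.
  have -> : v |: X = (v |: X :\ x) :|: (v |: X :\ y).
    apply/setP=> u; rewrite !inE; case: eqP => //= _.
    by case: (u =P x) => [->|_] /=; [rewrite xy xX | case: (u \in X); rewrite ?andbF].
  apply: merge => //.
  have s : X :\ x :\ y \subset (v |: X :\ x) :&: (v |: X :\ y).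
    by apply/subsetP=> u; rewrite !inE => /and3P[-> -> ->]; rewrite !orbT.
  apply: leq_trans (subset_leq_card s).
  move: X5; rewrite (cardsD1 x X) xX (cardsD1 y (X :\ x)) !inE yX eq_sym xy /=.
  by rewrite !add1n !ltnS.
have [x0 x0X cx0] : exists2 x0, x0 \in X &
    forall x, x \in X -> x != x0 -> ~~ clique (v |: X :\ x).
  have [/exists_inP[x0 x0X c0]|none] := boolP [exists x in X, clique (v |: X :\ x)].
    exists x0 => // x xX; apply: contraNN => c; apply/eqP; exact: uniq_clique.
  have /card_gt0P[x0 x0X] : (0 < #|X|)%N by apply: leq_trans X5.
  exists x0 => // x xX _; apply: contra none => c; apply/exists_inP; by exists x.
have X0 : (0 < #|X|)%N by apply: leq_trans X5.
have predX : #|X|.-1%:R = #|X|%:R - 1 :> rat by rewrite -subn1 natrB.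
have x5 : 5 <= #|X|%:R :> rat by rewrite ler_nat.
have small0 : (#|X|.-1 <= 3)%N = false by rewrite leqNgt -ltnS prednK ?X5.
have small1 : (#|X|.-1 <= 2)%N = false.
  by apply: contraFF small0 => /leq_trans; apply.
rewrite (big_setD1 x0) //= (eq_bigr (fun=> 7 / 2 - 6 / #|X|.-1%:R)); last first.
  move=> x /setD1P[xx0 xX]; rewrite /mean_gain cX // (negPf (cx0 _ xX xx0)).
  by rewrite small0.
rewrite sumr_const cX // -[_ *+ #|X|.-1]mulr_natl.
(* The clique value for [x0]; it is also below the other value, as [#|X| >= 4]. *)
have mean0 : 3 - 6 / #|X|%:R <= mean_gain v (X :\ x0).
  rewrite /mean_gain /mean_small (cX _ x0X) small0 small1 prednK // predX.
  case: ifP => _; first exact: lexx.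
  move: (#|X|%:R : rat) x5 => x x5; rewrite -subr_ge0.
  have -> : 7 / 2 - 6 / (x - 1) - (3 - 6 / x)
      = ((x - 4) * (x + 3)) / (2 * (x * (x - 1))).
    by field; rewrite !gt_eqF //; lra.
  by rewrite divr_ge0 ?mulr_ge0 //; lra.
rewrite predX -natr1; move: (#|X|%:R : rat) x5 mean0 => x x5 mean0.
(* Equality holds in this first comparison: the constants of [7 / 2 - 6 / D] are those for which one
   exceptional deletion is exactly affordable. *)
apply: le_trans (_ : 4 + ((3 - 6 / x) + (x - 1) * (7 / 2 - 6 / (x - 1))) <= _).
  have -> : (x - 1) * (7 / 2 - 6 / (x - 1)) = (x - 1) * (7 / 2) - 6.
    by field; rewrite gt_eqF //; lra.
  have -> : (x + 1) * (7 / 2 - 6 / x) = (x + 1) * (7 / 2) - 6 - 6 / x.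
    by field; rewrite gt_eqF //; lra.
  by lra.
by rewrite lerD2l lerD2r.
Qed.

End Clique.

(** * From rank growth to cliques, by deleting vertices *)

Section Growth.
Variables (V : finType) (h e : rel V) (Phi : {set V} -> nat).
Implicit Types (A B U X : {set V}) (u v w : V).

Hypothesis e_irr : irreflexive e.
Hypothesis e_sym : ssrbool.symmetric e.
Hypothesis h_sub_e : forall u v, u != v -> h u v -> e u v.
Hypothesis merge : forall A B, clique h A -> clique h B ->
  (2 < #|A :&: B|)%N -> clique h (A :|: B).
Hypothesis Phi_gain : forall v X, v \notin X ->
  (Phi X + gain h v (nbrs e v X) <= Phi (v |: X))%N.
Hypothesis Phi_full : forall U, (2 < #|U|)%N -> (3 * #|U| <= Phi U)%N -> clique h U.

(* 12-connectedness of the graph induced on [U], in terms of separations. *)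
Definition no_small_cut U := forall A B, A \subset U -> B \subset U ->
  A != set0 -> B != set0 -> [disjoint A & B] -> (#|U :\: (A :|: B)| < 12)%N ->
  exists u v, [/\ u \in A, v \in B & e u v].

(** Fewer than 12 neighbours of [w] would separate [w] from the remaining vertices of [U]. *)
Lemma min_degree U w : no_small_cut U -> (12 < #|U|)%N -> w \in U ->
  (12 <= #|nbrs e w U|)%N.
Proof.
move=> cutU U12 wU; rewrite leqNgt; apply/negP=> N12.
set N := nbrs e w U in N12.
have wN : w \notin N by rewrite inE e_irr andbF.
have NU : N \subset U by apply/subsetP=> u; rewrite inE => /andP[].
pose B := U :\: (w |: N).
have B0 : B != set0.
  rewrite -card_gt0 -subn_gt0 subn0 cardsD (setIidPr _) ?subUset ?sub1set ?wU //.
  by rewrite cardsU1 wN subn_gt0; apply: leq_ltn_trans U12.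
have [|||||u [v]] := cutU [set w] B _ _ _ B0.
- by rewrite sub1set.
- exact: subsetDl.
- by apply/set0Pn; exists w; rewrite inE.
- by rewrite disjoints1 !inE eqxx.
- suff -> : U :\: ([set w] :|: B) = N by [].
  apply/setP=> u; rewrite !inE; case: (u =P w) => [->|_] /=.
    by rewrite e_irr andbF.
  by case: (u \in U); case: (e w u).
case; rewrite !inE => /eqP-> /andP[/norP[_ ev] vU] wv.
by rewrite vU wv in ev.
Qed.

(** If the neighbours of [w] miss one side of a separation of [U :\ w], then [w] can join the other
    side, which gives a separation of [U]. Otherwise [w] has neighbours on both sides, and these are
    adjacent since they lie in a clique. *)
Lemma no_small_cut_setD1 U w : no_small_cut U -> w \in U ->
  clique h (w |: nbrs e w U) -> no_small_cut (U :\ w).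
Proof.
move=> cutU wU /cliqueP cw.
have wlogN A B : A \subset U :\ w -> B \subset U :\ w ->
    A != set0 -> B != set0 -> [disjoint A & B] ->
    (#|U :\ w :\: (A :|: B)| < 12)%N -> [disjoint nbrs e w U & A] ->
    exists u v, [/\ u \in A, v \in B & e u v].
  move=> AU BU A0 B0 AB small NA.
  have wA : w \notin A by apply/negP=> /(subsetP AU); rewrite !inE eqxx.
  have [||||||u [v [uA]]] := cutU A (w |: B).
  - exact: subset_trans AU (subsetDl _ _).
  - by rewrite subUset sub1set wU (subset_trans BU (subsetDl _ _)).
  - by [].
  - by apply/set0Pn; exists w; rewrite !inE eqxx.
  - by rewrite -setI_eq0 setIUr setU_eq0 !setI_eq0 AB disjoint_sym disjoints1 wA.
  - suff -> : U :\: (A :|: (w |: B)) = U :\ w :\: (A :|: B) by [].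
    apply/setP=> u; rewrite !inE; case: (u == w); rewrite /= ?orbT ?andbF //.
  rewrite !inE => /predU1P[->|vB] uv; last by exists u, v.
  have uU : u \in U by have := subsetP AU _ uA; rewrite inE => /andP[].
  have uN : u \in nbrs e w U by rewrite inE uU e_sym.
  by rewrite (disjointFr NA uN) in uA.
move=> A B AU BU A0 B0 AB small.
have [NA|] := boolP [disjoint nbrs e w U & A]; first exact: wlogN.
have [NB _|] := boolP [disjoint nbrs e w U & B].
  have [||u [v [uB vA uv]]] := wlogN B A BU AU B0 A0 _ _ NB.
  - by rewrite disjoint_sym.
  - by rewrite setUC.
  - by exists v, u; rewrite e_sym.
move=> /pred0Pn[b /= /andP[bN bB]] /pred0Pn[a /= /andP[aN aA]].
exists a, b; split=> //; apply: h_sub_e; last by rewrite cw // setU1r.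
by apply: contraTneq aA => ->; rewrite (disjointFl AB bB).
Qed.

Lemma clique_of_no_small_cut U : (12 < #|U|)%N -> no_small_cut U -> clique h U.
Proof.
have [k] := ubnP #|U|; elim: k U => // k IH U leU U12 cutU.
have [/exists_inP[w wU cw]|] :=
  boolP [exists w in U, clique h (w |: nbrs e w U)].
  have N12 := min_degree cutU U12 wU.
  have NU : nbrs e w U \subset U :\ w.
    apply/subsetP=> u; rewrite !inE => /andP[->].
    by case: (u =P w) => [->|//]; rewrite e_irr.
  have cardU : #|U| = #|U :\ w|.+1 by rewrite (cardsD1 w U) wU.
  have [U13|U13] := ltnP 12 #|U :\ w|.
    have cU : clique h (U :\ w).
      by apply: IH => //; [rewrite -cardU | apply: no_small_cut_setD1].
    have := merge cU cw; rewrite setUCA setUA setD1K //.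
    rewrite (setUidPl (subset_trans NU (subsetDl _ _))); apply.
    apply: leq_trans (subset_leq_card (_ : nbrs e w U \subset _)).
      exact: leq_trans N12.
    by rewrite subsetI NU subsetUr.
  have NE : nbrs e w U = U :\ w.
    by apply/eqP; rewrite eqEcard NU (leq_trans U13).
  by rewrite NE setD1K in cw.
move/exists_inPn => nc; apply: Phi_full; first by apply: leq_trans U12.
have := @order_average V e (fun X => (Phi X)%:R) (fun v X => (gain h v X)%:R)
  (mean_gain h) e_irr _ _ _ U.
move=> /(_ (ler0n _ _)) H.
rewrite -(ler_nat rat); apply: le_trans (H _ _).
- rewrite natrM mulr_natr -sumr_const; apply: ler_sum => v vU.
  have N12 := min_degree cutU U12 vU.
  rewrite /mean_gain (negPf (nc _ vU)) orbF leqNgt (leq_trans _ N12) //=.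
  have N12' : 12 <= #|nbrs e v U|%:R :> rat by rewrite ler_nat.
  have : 6 / #|nbrs e v U|%:R <= 1 / 2 :> rat.
    rewrite ler_pdivrMr; first by lra.
    by apply: lt_le_trans N12'.
  by lra.
- by move=> v X vX; rewrite -natrD ler_nat Phi_gain.
- by move=> v X; apply: mean_gain_rec.
Qed.

End Growth.

(** * The closure of a highly connected graph *)

Lemma subset_of_card (T : finType) (A : {set T}) k :
  (k <= #|A|)%N -> exists2 B : {set T}, B \subset A & #|B| = k.
Proof.
case/card_geqP=> s [us <- sA]; exists [set x in s].
  by apply/subsetP=> x; rewrite inE => /sA.
by rewrite cardsE (card_uniqP us).
Qed.

Section Closure.
Variables (R : numFieldType) (n : nat) (p : 'I_n -> R * R) (W : 'M[R]_(3 * n)).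
Hypothesis p_generic : generic_config p.
Implicit Types (X U : {set 'I_n}) (u v w : 'I_n).

(** Membership of [uv] in the closure of an edge set whose rows span [W]. *)
Definition linked u v := (edge_row p u v <= W)%MS.

Notation rho X := (\rank (pair_span p (pairs linked X))).

Lemma linked_refl : reflexive linked.
Proof. by move=> u; rewrite /linked edge_row_id sub0mx. Qed.

Lemma linked_sym u v : linked u v = linked v u.
Proof. by rewrite /linked edge_row_sym eqmx_opp. Qed.

Lemma linked_pair_span X u v :
  (edge_row p u v <= pair_span p (pairs linked X))%MS -> linked u v.
Proof.
move/submx_trans; apply; apply: pair_spanP => x y.
by rewrite inE => /and3P[].
Qed.

(** The linked pairs in [U] then reach the maximal rank of all pairs in [U], so the two spans
    coincide. *)
Lemma clique_of_rank U : (2 < #|U|)%N -> (3 * #|U| <= rho U + 6)%N ->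
  clique linked U.
Proof.
move=> U3 rU; apply/cliqueP=> u v uU vU.
have sK : (pair_span p (pairs linked U) <= pair_span p (setX U U))%MS.
  apply: pair_spanS; apply/subsetP=> e; rewrite !inE.
  by case/and3P=> -> ->.
have rK := rank_pair_span_le p_generic U3 (subxx (setX U U)).
apply: (@linked_pair_span U).
apply: submx_trans (_ : (pair_span p (setX U U) <= _)%MS).
  by apply: pair_span_sup; rewrite inE /= uU.
rewrite -(mxrank_leqif_sup sK) eqn_leq mxrankS //=.
by rewrite -(leq_add2r 6) (leq_trans rK).
Qed.

(* By 0-extensions, [K_5] minus the edge [xy] has the rank of [K_5]. *)
Lemma linked_merge A B : clique linked A -> clique linked B ->
  (2 < #|A :&: B|)%N -> clique linked (A :|: B).
Proof.
move=> /cliqueP cA /cliqueP cB AB.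
have key x y : x \in A -> x \notin B -> y \in B -> y \notin A -> linked x y.
  move=> xA xB yB yA.
  have /card_gt2P[a [b [c [[aAB bAB cAB] [ab bc ca]]]]] := AB.
  pose C := [set a; b; c].
  have C3 : #|C| = 3 by rewrite /C setUC cardsU1 cards2 ab !inE negb_or ca eq_sym bc.
  have CAB u : u \in C -> u \in A :&: B.
    by rewrite !inE -!orbA => /or3P[]/eqP->; rewrite -in_setI.
  have CA u : u \in C -> u \in A by move=> /CAB; rewrite inE => /andP[].
  have CB u : u \in C -> u \in B by move=> /CAB; rewrite inE => /andP[].
  have xC : x \notin C by apply: contra xB; apply: CB.
  have yC : y \notin C by apply: contra yA; apply: CA.
  have xy : x != y by apply: contraNneq yA => <-.
  have ext := rank_pairs_0extension (h := linked) p_generic.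
  (* Successive 0-extensions give ranks 1, 3, 6 and 9, and [9 = 3 * 5 - 6]. *)
  have r2 : (1 <= rho [set a; b])%N.
    have := ext a [set b] [set b]; rewrite cards1 inE => /(_ ab (subxx _) isT) H.
    apply: leq_trans (leq_trans (leq_addl _ _) (H _)) _ => // u.
    by rewrite inE => /eqP->; apply: cA; apply: CA; rewrite !inE eqxx ?orbT.
  have r3 : (3 <= rho C)%N.
    have cab : c \notin [set a; b] by rewrite !inE negb_or ca eq_sym bc.
    have := ext c [set a; b] [set a; b] cab (subxx _).
    rewrite cards2 ab => /(_ isT) H; rewrite /C setUC.
    apply: leq_trans (H _); first exact: (@leq_add 1 2 _ _ r2).
    move=> u uab; apply: cA; apply: CA; last by rewrite inE uab.
    by rewrite !inE eqxx orbT.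
  have r4 : (6 <= rho (x |: C))%N.
    have := ext x C C xC (subxx _); rewrite C3 => /(_ isT) H.
    apply: leq_trans (H _); first exact: (@leq_add 3 3 _ _ r3).
    by move=> u uC; apply: cA => //; apply: CA.
  have yxC : y \notin x |: C by rewrite in_setU1 eq_sym (negPf xy).
  have r5 : (9 <= rho (y |: (x |: C)))%N.
    have := ext y (x |: C) C yxC (subsetUr _ _); rewrite C3 => /(_ isT) H.
    apply: leq_trans (H _); first exact: (@leq_add 6 3 _ _ r4).
    by move=> u uC; apply: cB => //; apply: CB.
  have cU : #|y |: (x |: C)| = 5 by rewrite !cardsU1 yxC xC C3.
  have /cliqueP : clique linked (y |: (x |: C)).
    by apply: clique_of_rank; rewrite cU //; apply: (@leq_add 9 6 _ _ r5).
  by apply; rewrite !inE eqxx ?orbT.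
apply/cliqueP=> u v; rewrite !inE.
have [uA|uA] := boolP (u \in A); have [uB|uB] := boolP (u \in B);
  have [vA|vA] := boolP (v \in A); have [vB|vB] := boolP (v \in B) => //= _ _;
  try (by apply: cA); try (by apply: cB); try (by apply: key).
by rewrite linked_sym; apply: key.
Qed.

Lemma rho_gain_le3 v X (M : {set 'I_n}) : v \notin X -> M \subset X ->
  {in M, forall u, linked v u} ->
  (rho X + minn #|M| 3 <= rho (v |: X))%N.
Proof.
move=> vX MX lM.
have [M' M'M cM'] := subset_of_card (geq_minl #|M| 3).
rewrite -cM'; apply: rank_pairs_0extension => //.
- exact: subset_trans M'M MX.
- by rewrite cM' geq_minr.
- by move=> u /(subsetP M'M); apply: lM.
Qed.

(** A 1-extension on an unlinked pair [x], [y] of [M] together with any two further vertices of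
    [M]. *)
Lemma rho_gain4 v X (M : {set 'I_n}) : v \notin X -> M \subset X ->
  {in M, forall u, linked v u} -> (3 < #|M|)%N -> ~~ clique linked M ->
  (rho X + 4 <= rho (v |: X))%N.
Proof.
move=> vX MX lM M4 /forall_inPn[x xM] /forall_inPn[y yM nxy].
have xy : x != y by apply: contraNneq nxy => ->; rewrite linked_refl.
have : (1 < #|M :\: [set x; y]|)%N.
  have sM : [set x; y] \subset M by rewrite subUset !sub1set xM.
  by rewrite cardsD (setIidPr sM) cards2 xy ltn_subRL.
case/card_gt1P=> a [b []]; rewrite !inE !negb_or.
move=> /andP[/andP[ax ay] aM] /andP[/andP[bx b_y] bM] ab.
apply: (@rank_pairs_1extension _ _ _ _ _ _ x y a b) => //.
- by move=> u; rewrite !inE => /or4P[]/eqP->; apply: (subsetP MX).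
- rewrite /= !inE !negb_or xy ab [x == a]eq_sym [x == b]eq_sym [y == a]eq_sym.
  by rewrite [y == b]eq_sym ax ay bx b_y.
- by move=> u; rewrite !inE => /or4P[]/eqP->; apply: lM.
- by apply: contra nxy; apply: linked_pair_span.
Qed.

End Closure.

(** * Deleting at most six edges from a 12-connected graph *)

Section Deletion.
Variables (R : numFieldType) (n : nat) (F S : {set edgeK n}) (p : 'I_n -> R * R).
Hypotheses (p_generic : generic_config p) (F_conn : k_connected 12 F).
Hypothesis S6 : (#|S| <= 6)%N.
Implicit Types (X U : {set 'I_n}) (u v w : 'I_n).

Let W := (\sum_(f in (F :\: S)%SET) <<cofactor_row p f>>)%MS.
Local Notation h := (linked p W).
Local Notation rho X := (\rank (pair_span p (pairs h X))).

(* Linked pairs are included so that a clique of [h] is also one of this graph. *)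
Definition augmented u v := (u != v) && (h u v || adj F u v).

(** These edges all lie in [S]. Adding their number to the rank costs at most 6, the gap between
    [3 * #|U|] and the complete rank. *)
Definition unlinked_edges X : {set edgeK n} :=
  [set f in F | [&& (val f).1 \in X, (val f).2 \in X & ~~ h (val f).1 (val f).2]].

Lemma adj_sym u v : adj F u v = adj F v u.
Proof. by apply: eq_existsb => f; rewrite orbC. Qed.

Lemma augmented_sym : ssrbool.symmetric augmented.
Proof. by move=> u v; rewrite /augmented eq_sym linked_sym adj_sym. Qed.

Lemma adj_neq u v : adj F u v -> u != v.
Proof.
case/exists_inP=> -[[i j] /= lij] _ /orP[]/andP[/eqP <- /eqP <-].
  by rewrite neq_ltn lij.
by rewrite neq_ltn lij orbT.
Qed.

Lemma card_unlinked_edges X : (#|unlinked_edges X| <= 6)%N.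
Proof.
apply: leq_trans S6; apply/subset_leq_card/subsetP=> f.
rewrite inE => /and4P[fF _ _]; apply: contraR => fS.
rewrite /linked -cofactor_rowE; apply: (sumsmx_sup f); last by rewrite genmxE.
by rewrite inE fS.
Qed.

Lemma unlinked_edges_gain v X : v \notin X ->
  (#|unlinked_edges X| + #|[set u in nbrs augmented v X | ~~ h v u]|
     <= #|unlinked_edges (v |: X)|)%N.
Proof.
move=> vX; set T := [set u in _ | _].
pose atv := [set f : edgeK n | ((val f).1 == v) || ((val f).2 == v)].
(* Each unlinked neighbour of [v] is the far end of an unlinked edge at [v], so [other] maps these
   edges onto a set containing [T]. *)
pose other (f : edgeK n) := if (val f).1 == v then (val f).2 else (val f).1.
rewrite -(cardsID atv (unlinked_edges (v |: X))) addnC leq_add //.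
  apply: leq_trans (leq_imset_card other _).
  apply/subset_leq_card/subsetP=> u; rewrite !inE => /andP[/andP[uX]].
  case/andP=> vu; rewrite orbC => /orP[/exists_inP[f fF fE]|->//] nh.
  have [e1 e2] : (val f).1 \in v |: X /\ (val f).2 \in v |: X.
    by case/orP: fE => /andP[/eqP-> /eqP->]; rewrite !inE eqxx uX ?orbT.
  apply/imsetP; exists f; last first.
    rewrite /other; case/orP: fE => /andP[/eqP-> /eqP->]; first by rewrite eqxx.
    by rewrite eq_sym (negPf vu).
  rewrite in_setI [f \in atv]inE [f \in unlinked_edges _]inE fF e1 e2 /=.
  by case/orP: fE => /andP[/eqP-> /eqP->]; rewrite eqxx ?orbT ?andbT // linked_sym.
apply/subset_leq_card/subsetP=> f.
rewrite in_setD [f \in atv]inE [f \in unlinked_edges _]inE => /and4P[fF f1 f2 nh].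
rewrite inE fF !in_setU1 f1 f2 !orbT nh negb_or /= !andbT.
by apply/andP; split; apply: contraNneq vX => <-.
Qed.

(** Linked neighbours raise the rank, unlinked ones the edge count. A single unlinked neighbour
    already pays for the bonus; without any, [v] is linked to all of [N], so a missing link lies
    inside [N] and a 1-extension applies. *)
Lemma rank_plus_unlinked_gain v X : v \notin X ->
  (rho X + #|unlinked_edges X| + gain h v (nbrs augmented v X)
     <= rho (v |: X) + #|unlinked_edges (v |: X)|)%N.
Proof.
move=> vX; have bad := unlinked_edges_gain vX.
set N := nbrs augmented v X in bad *.
have NX : N \subset X by apply/subsetP=> u; rewrite inE => /andP[].
have cN : #|N| = (#|[set u in N | h v u]| + #|[set u in N | ~~ h v u]|)%N.
  rewrite -(cardsID [set u | h v u] N); congr (_ + _)%N; apply: eq_card => u;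
    by rewrite !inE // andbC.
set M := [set u in N | h v u] in cN.
have MX : M \subset X.
  by apply: subset_trans NX; apply/subsetP=> u; rewrite inE => /andP[].
have lM : {in M, forall u, h v u} by move=> u; rewrite inE => /andP[].
have g3 := rho_gain_le3 p_generic vX MX lM.
have [T0|T0] := posnP #|[set u in N | ~~ h v u]|.
  have NM : N = M.
    apply/eqP; rewrite eq_sym eqEcard cN T0 addn0 leqnn andbT.
    by apply/subsetP=> u; rewrite inE => /andP[].
  have [bonus|nobonus] := boolP ((3 < #|N|)%N && ~~ clique h (v |: N)).
    have /andP[N4 nc] := bonus.
    have ncM : ~~ clique h M.
      apply: contra nc => /cliqueP cM; apply/cliqueP=> x y; rewrite NM.
      move=> /setU1P[->|xM] /setU1P[->|yM]; first exact: linked_refl.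
      - exact: lM.
      - by rewrite linked_sym; apply: lM.
      - exact: cM.
    have g4 : (rho X + 4 <= rho (v |: X))%N.
      by apply: (rho_gain4 p_generic vX MX lM) => //; rewrite -NM.
    rewrite /gain bonus (minn_idPr _) ?(ltnW N4) //.
    by rewrite addnAC leq_add // (leq_trans (leq_addr _ _) bad).
  rewrite /gain (negPf nobonus) addn0 NM addnAC leq_add //.
  exact: leq_trans (leq_addr _ _) bad.
suff gT : (gain h v N <= minn #|M| 3 + #|[set u in N | ~~ h v u]|)%N.
  rewrite -(leq_add2l (rho X + #|unlinked_edges X|)) in gT.
  apply: leq_trans gT _; rewrite addnACA; exact: leq_add.
rewrite /gain cN; move: #|M| #|_| T0 => m t t0.
case: (~~ clique h _); rewrite ?andbT ?andbF; last by lia.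
by case: ltnP => /=; lia.
Qed.

Lemma clique_of_rank_plus_unlinked U : (2 < #|U|)%N ->
  (3 * #|U| <= rho U + #|unlinked_edges U|)%N -> clique h U.
Proof.
move=> U3 r; apply: (clique_of_rank p_generic) => //.
by apply: leq_trans r _; rewrite leq_add2l card_unlinked_edges.
Qed.

(** Without an edge between them, [A] would be closed under adjacency in [F] minus the fewer than 12
    vertices outside [A] and [B], so no path could reach [B]. *)
Lemma no_small_cut_setT : no_small_cut augmented [set: 'I_n].
Proof.
move=> A B _ _ /set0Pn[a aA] /set0Pn[b bB] AB small.
have [/existsP[u /existsP[v /and3P[]]]|none] :=
  boolP [exists u, exists v, [&& u \in A, v \in B & augmented u v]].
  by exists u, v.
set C := _ :\: _ in small.
have inC u : (u \in C) = ~~ ((u \in A) || (u \in B)) by rewrite !inE andbT.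
have noedge u v : u \in A -> v \in B -> ~~ adj F u v.
  move=> uA vB; apply: contra none => uv; apply/existsP; exists u; apply/existsP.
  by exists v; rewrite uA vB /augmented adj_neq // uv orbT.
have cl : fingraph.closed
    [rel x y | adj F x y && (x \notin C) && (y \notin C)] (mem A).
  move=> x y /=; rewrite !inC !negbK => /andP[/andP[xy /orP[xA|xB]] /orP[yA|yB]].
  - by rewrite xA yA.
  - by have := noedge _ _ xA yB; rewrite xy.
  - by have := noedge _ _ yA xB; rewrite adj_sym xy.
  - by rewrite (disjointFl AB xB) (disjointFl AB yB).
have aC : a \notin C by rewrite inC aA.
have bC : b \notin C by rewrite inC bB orbT.
have := closed_connect cl (F_conn.2 C small a b aC bC).
by rewrite aA (disjointFl AB bB).
Qed.

Lemma all_linked u v : h u v.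
Proof.
have n13 : (12 < #|[set: 'I_n]|)%N by rewrite cardsT card_ord F_conn.1.
have : clique h [set: 'I_n].
  apply: (clique_of_no_small_cut (e := augmented)
            (Phi := fun X => (rho X + #|unlinked_edges X|)%N)) n13 _.
  - by move=> w; rewrite /augmented eqxx.
  - exact: augmented_sym.
  - by move=> x y xy hxy; rewrite /augmented xy hxy.
  - exact: linked_merge.
  - exact: rank_plus_unlinked_gain.
  - exact: clique_of_rank_plus_unlinked.
  - exact: no_small_cut_setT.
by move/cliqueP; apply; rewrite inE.
Qed.

End Deletion.

Theorem theorem7p2 (R : realType) (n : nat) (F S : {set edgeK n})
  (p : 'I_n -> R * R) :
  generic_config p ->
  k_connected 12 F ->
  S \subset F -> (#|S| <= 6)%N ->
  spans_cofactor p (F :\: S).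
Proof.
move=> gp F12 _ S6 e; rewrite cofactor_rowE.
exact: (all_linked gp F12 S6).
Qed.
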